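(* For every $r\ge 3$ and every $n\ge r+1$ such that $n-r$ is even, there exists a $1$-extreme marked $r$-uniform clique $H$ on $n$ vertices such that every subhypergraph of $H$ on $n-1$ vertices has an agreeing linear order but $H$ does not have an agreeing linear order.
   Context: An $r$-uniform clique is a complete $r$-uniform hypergraph $H$ with no repeated edges, i.e. its edge set $E(H)$ consists of all $r$-element subsets of its vertex set $V(H)$. A $1$-extreme marked $r$-uniform clique is an $r$-uniform clique together with, for each edge $e\in E(H)$, one marked vertex $\widehat{e}\in e$. The subhypergraph of $H$ on a vertex set $U\subseteq V(H)$ is the one with vertex set $U$ whose edges are all edges $e\in E(H)$ with $e\subseteq U$, with the same marks. A linear order $L$ on the vertex set of a $1$-extreme marked hypergraph is an agreeing linear order if, for every edge $e$, the vertex $\widehat{e}$ is either the $L$-minimal or the $L$-maximal element of $e$. *)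

(* Defs.v *)
From mathcomp Require Import all_boot.

Set Implicit Arguments.
Unset Strict Implicit.
Unset Printing Implicit Defensive.

(* 1-extreme marked hypergraphs with vertices taken from an ambient finite     *)
(* type T. Edges form a set, so there are no repeated edges; the value of      *)
(* [mark] outside [edges] is irrelevant.                                       *)
Record marked_hypergraph (T : finType) := MarkedHypergraph {
  verts : {set T};
  edges : {set {set T}};
  mark : {set T} -> T;
  edges_sub : forall e, e \in edges -> e \subset verts;
  mark_in : forall e, e \in edges -> mark e \in e
}.

Definition uniform_clique (T : finType) (r : nat) (H : marked_hypergraph T) : Prop :=
  edges H = [set e : {set T} | (e \subset verts H) && (#|e| == r)].

Section SubHypergraph.

Variables (T : finType) (H : marked_hypergraph T) (U : {set T}).

Definition sub_edges : {set {set T}} := [set e in edges H | e \subset U].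

Lemma sub_edges_sub e : e \in sub_edges -> e \subset U.
Proof. by rewrite inE => /andP[]. Qed.

Lemma sub_mark_in e : e \in sub_edges -> mark H e \in e.
Proof. by rewrite inE => /andP[/mark_in]. Qed.

Definition subhypergraph (_ : U \subset verts H) : marked_hypergraph T :=
  MarkedHypergraph sub_edges_sub sub_mark_in.

End SubHypergraph.

(* [L] is read as a non-strict order; its values outside [V] are irrelevant. *)
Definition linear_order_on (T : finType) (V : {set T}) (L : rel T) : Prop :=
  [/\ {in V, reflexive L}, {in V &, antisymmetric L},
      {in V & &, transitive L} & {in V &, total L}].

Definition minimal_in (T : finType) (L : rel T) (e : {set T}) (x : T) : Prop :=
  x \in e /\ forall y, y \in e -> L y x -> y = x.

Definition maximal_in (T : finType) (L : rel T) (e : {set T}) (x : T) : Prop :=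
  x \in e /\ forall y, y \in e -> L x y -> y = x.

Definition agreeing_order (T : finType) (H : marked_hypergraph T) (L : rel T) : Prop :=
  linear_order_on (verts H) L /\
  forall e, e \in edges H ->
    minimal_in L e (mark H e) \/ maximal_in L e (mark H e).

Definition has_agreeing_order (T : finType) (H : marked_hypergraph T) : Prop :=
  exists L : rel T, agreeing_order H L.

(* Main.v *)
Require Import Defs.
From mathcomp Require Import all_boot.
From mathcomp Require Import zify.

(** Put n = m + q with q = r - 3, so that m >= 5 is odd, and split the vertices
    into a cycle of length m and q apexes.  The arc at i is the edge made of
    three consecutive cycle vertices i, i+1, i+2 and of all the apexes; it is
    marked at its middle vertex i+1.  Every other edge is marked at its vertex
    of smallest label, where the cycle vertices are labelled before the apexes.

    No order agrees with all the arcs: i+1 being extreme among i, i+1, i+2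
    means that the order goes up from i to i+1 exactly when it goes down from
    i+1 to i+2, so ups and downs alternate around a cycle of odd length
    ([no_alternating_odd_cycle]).

    Conversely a two-colouring of the vertices yields an order: first the
    vertices of one colour with increasing labels, then those of the other
    colour with decreasing labels.  In this order a vertex is extreme in an edge
    as soon as each other vertex of the edge has a larger label or the other
    colour ([agreeing_order_of_colouring]).  Edges marked at the smallest label
    thus agree whatever the colouring, and an arc agrees if its middle differs
    in colour from its two neighbours on the cycle.  Deleting an apex destroys
    every arc; deleting a cycle vertex leaves a path, which is two-colourable
    ([path_colour_ordS]).  So every deletion can be ordered. *)

(** * Orders from colourings *)

(** The order lists the low vertices by increasing label and then the high ones
    by decreasing label, so that labels grow from both ends towards the middle:
    a low mark is then the minimum of its edge and a high mark the maximum. *)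
Lemma agreeing_order_of_colouring {T : finType} (H : marked_hypergraph T)
    (label : T -> nat) (high : T -> bool) :
  injective label ->
  (forall e y, e \in edges H -> y \in e -> y != mark H e ->
     label (mark H e) < label y \/ high y = ~~ high (mark H e)) ->
  has_agreeing_order H.
Proof.
move=> label_inj markP; set N := \max_(y : T) label y.
have labelN x : label x <= N by apply: leq_bigmax.
(* The reflection [N.*2.+1 - _] sends the labels [0..N] above all of them. *)
pose rank x := if high x then N.*2.+1 - label x else label x.
have rank_inj : injective rank.
  move=> x y; rewrite /rank => eq_xy; apply: label_inj.
  by move: (labelN x) (labelN y) eq_xy; case: (high x); case: (high y); lia.
exists (fun x y => rank x <= rank y); split.
  split=> [x _|x y _ _|y x z _ _ _|x y _ _] //=.
  - by move=> /anti_leq /rank_inj.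
  - exact: leq_trans.
  - exact: leq_total.
move=> e eH; have me := mark_in eH.
case hm: (high (mark H e)); [right | left]; split=> // y ye;
  apply: contraTeq => y_neq; move: (markP _ _ eH ye y_neq) (labelN y);
  move: (labelN (mark H e)); rewrite /rank hm; case: (high y); lia.
Qed.

(** * Odd cycles *)

Lemma val_ordS {m} (i : 'I_m) : ordS i = (if i.+1 == m then 0 else i.+1) :> nat.
Proof.
rewrite /=; case: eqP => [->|ne]; first by rewrite modnn.
by rewrite modn_small //; have := ltn_ord i; lia.
Qed.

Lemma no_alternating_odd_cycle {m} (f : 'I_m -> bool) :
  odd m -> ~ (forall i, f (ordS i) = ~~ f i).
Proof.
move=> odd_m alt; have m_gt0 := odd_gt0 odd_m; pose z := Ordinal m_gt0.
have f_iter k : f (iter k (@ordS m) z) = odd k (+) f z.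
  by elim: k => //= k IHk; rewrite alt IHk addNb.
have val_iter k : iter k (@ordS m) z = k %% m :> nat.
  by elim: k => [|k IHk]; rewrite ?mod0n //= IHk -addn1 modnDml addn1.
have iter_m : iter m (@ordS m) z = z by apply: val_inj; rewrite /= val_iter modnn.
by have := f_iter m; rewrite iter_m odd_m; case: (f z).
Qed.

(** The parity of the distance from [v] to [i] along a cycle of odd length,
    up to a constant: passing from [m.-1] to [0] does not change the parity of
    the label, which the second summand makes up for. *)
Definition path_colour {m} (v i : 'I_m) : bool := odd i (+) (i < v).

Lemma path_colour_ordS {m} (v i : 'I_m) :
  odd m -> i != v -> ordS i != v -> path_colour v (ordS i) = ~~ path_colour v i.
Proof.
move=> odd_m; rewrite /path_colour -2!(inj_eq val_inj) [\val (ordS i)]val_ordS val_ordS.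
move: (ltn_ord i) (ltn_ord v).
case: (i.+1 =P m) => [im|_] lt_i lt_v ne1 ne2 /=.
  have -> : (i < v) = false by lia.
  have -> : 0 < v by rewrite lt0n eq_sym.
  by move: (odd_m); rewrite -[in odd m]im /=; case: (odd i).
have -> : (i.+1 < v) = (i < v) by rewrite ltn_neqAle ne2.
by rewrite addNb.
Qed.

(** * The arcs *)

Definition label {m q} (x : 'I_m + 'I_q) : nat :=
  match x with inl i => i | inr j => m + j end.

Lemma label_inj {m q} : injective (@label m q).
Proof.
case=> [i|i] [j|j] /= eq_ij.
- by congr inl; apply: val_inj.
- by have := ltn_ord i; lia.
- by have := ltn_ord j; lia.
- by congr inr; apply: val_inj => /=; lia.
Qed.

Definition arc {m} q (i : 'I_m) : {set 'I_m + 'I_q} :=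
  [set x | match x with
           | inl j => j \in [:: i; ordS i; ordS (ordS i)]
           | inr _ => true
           end].

Lemma uniq_arc {m} (i : 'I_m) : 2 < m -> uniq [:: i; ordS i; ordS (ordS i)].
Proof.
move=> m_gt2; rewrite /= !inE negb_or -!val_eqE ![val (ordS _)]val_ordS.
by have := ltn_ord i; do !case: eqP => //=; lia.
Qed.

Lemma card_arc {m} q (i : 'I_m) : 2 < m -> #|arc q i| = q + 3.
Proof.
move=> m_gt2; rewrite -sum1_card big_sumType /= addnC; congr (_ + _).
  by under eq_bigl => j do rewrite inE; rewrite sum1_card card_ord.
under eq_bigl => j do rewrite inE.
by rewrite sum1_card (card_uniqP (uniq_arc i m_gt2)).
Qed.

Lemma mem_arc {m q} (i j : 'I_m) :
  (inl j \in arc q i) = [|| j == i, j == ordS i | j == ordS (ordS i)].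
Proof. by rewrite !inE. Qed.

(** This fails for [m = 3], where the three arcs are the same set and would ask
    for three marks. *)
Lemma arc_inj {m q} : 3 < m -> injective (arc q : 'I_m -> _).
Proof.
move=> m_gt3 i j eq_arc; apply: val_inj.
have : inl i \in arc q j by rewrite -eq_arc mem_arc eqxx.
have : inl (ordS i) \in arc q j by rewrite -eq_arc mem_arc eqxx orbT.
have : inl (ordS (ordS i)) \in arc q j by rewrite -eq_arc mem_arc eqxx !orbT.
rewrite !mem_arc -!val_eqE ![val (ordS _)]val_ordS /=.
have := ltn_ord i; have := ltn_ord j.
by do !case: eqP => //=; lia.
Qed.

(** * The marking *)

Lemma arc_marking_exists {m} q : 3 < m ->
  exists mk : {set 'I_m + 'I_q} -> 'I_m + 'I_q,
    [/\ forall e, e != set0 -> mk e \in e,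
        forall i, mk (arc q i) = inl (ordS i)
      & forall e, (exists i, e = arc q i) \/
                  (forall y, y \in e -> label (mk e) <= label y)].
Proof.
move=> m_gt3; have x0 : 'I_m by exists 0; lia.
have mkP e : exists x : 'I_m + 'I_q,
    [/\ e != set0 -> x \in e, forall i, e = arc q i -> x = inl (ordS i)
      & (exists i, e = arc q i) \/ (forall y, y \in e -> label x <= label y)].
  case: (pickP [pred i | e == arc q i]) => [i /eqP -> | no_arc].
    exists (inl (ordS i)); split; last by left; exists i.
      by rewrite mem_arc eqxx orbT.
    by move=> j /(arc_inj m_gt3) ->.
  have not_arc i : e <> arc q i by move=> eq_e; have := no_arc i; rewrite /= eq_e eqxx.
  case: (set_0Vmem e) => [-> | [x1 x1e]].
    exists (inl x0); split; first by rewrite eqxx.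
      move=> i eq0; have := card_arc q i (ltnW m_gt3).
      by rewrite -eq0 cards0 addn3.
    by right=> y; rewrite inE.
  case: (arg_minnP label x1e) => x xe x_min.
  by exists x; split=> // [i /not_arc //|]; right.
have [mk {}mkP] := fin_all_exists mkP.
exists mk; split=> [e|i|e]; first by case: (mkP e).
  by case: (mkP (arc q i)) => _ /(_ i erefl).
by case: (mkP e).
Qed.

(** An order alternates along each arc, since the mark of the arc is a peak or
    a valley of the order on its three cycle vertices. *)
Lemma arcs_not_agreeing {m q} (H : marked_hypergraph ('I_m + 'I_q)%type) :
  2 < m -> odd m ->
  (forall i, arc q i \in edges H /\ mark H (arc q i) = inl (ordS i)) ->
  ~ has_agreeing_order H.
Proof.
move=> m_gt2 odd_m arcH [L [[_ _ _ tot] agree]].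
apply: (no_alternating_odd_cycle (fun i => L (inl i) (inl (ordS i)))) => // i.
have [eH mk_e] := arcH i.
have inV j : inl j \in arc q i -> inl j \in verts H.
  by move/(subsetP (edges_sub eH)).
have /and3P[] := uniq_arc i m_gt2; rewrite !inE negb_or.
case/andP=> ne1 _ ne2 _.
have a0 : inl i \in arc q i by rewrite mem_arc eqxx.
have a1 : inl (ordS i) \in arc q i by rewrite mem_arc eqxx orbT.
have a2 : inl (ordS (ordS i)) \in arc q i by rewrite mem_arc eqxx !orbT.
have t1 := tot _ _ (inV _ a0) (inV _ a1).
have t2 := tot _ _ (inV _ a1) (inV _ a2).
have inl_neq (j k : 'I_m) : j != k -> inl j <> inl k :> 'I_m + 'I_q.
  by move=> /eqP ne [].
have := agree _ eH; rewrite mk_e => -[] [_ ext].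
- have /negbTE n0 : ~~ L (inl i) (inl (ordS i)).
    by apply/negP=> /(ext _ a0); apply: inl_neq.
  have /negbTE n2 : ~~ L (inl (ordS (ordS i))) (inl (ordS i)).
    by apply/negP=> /(ext _ a2); apply: inl_neq; rewrite eq_sym.
  by rewrite n0; move: t2; rewrite n2 orbF => ->.
- have /negbTE n0 : ~~ L (inl (ordS i)) (inl i).
    by apply/negP=> /(ext _ a0); apply: inl_neq.
  have /negbTE n2 : ~~ L (inl (ordS i)) (inl (ordS (ordS i))).
    by apply/negP=> /(ext _ a2); apply: inl_neq; rewrite eq_sym.
  by rewrite n2; move: t1; rewrite n0 orbF => ->.
Qed.

Theorem proposition13 :
  forall r n : nat, 3 <= r -> r + 1 <= n -> ~~ odd (n - r) ->
  exists (T : finType) (H : marked_hypergraph T),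
    [/\ uniform_clique r H,
        #|verts H| = n,
        (forall (U : {set T}) (hU : U \subset verts H),
           #|U| = n - 1 -> has_agreeing_order (subhypergraph hU))
      & ~ has_agreeing_order H].
Proof.
move=> r n r_ge3 n_gt n_even; pose q := r - 3; pose m := n - r + 3.
have odd_m : odd m by rewrite oddD (negbTE n_even).
have m_gt3 : 3 < m by lia.
have rE : r = q + 3 by lia.
have nE : n = m + q by lia.
have [mk [mk_in mk_arc mk_min]] := arc_marking_exists q m_gt3.
pose T : finType := ('I_m + 'I_q)%type.
pose E := [set e : {set T} | (e \subset [set: T]) && (#|e| == r)].
have E_sub e : e \in E -> e \subset [set: T] by rewrite inE => /andP[].
have E_mk e : e \in E -> mk e \in e.
  by rewrite inE => /andP[_ /eqP e_r]; apply: mk_in; rewrite -card_gt0 e_r rE addn3.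
pose H := MarkedHypergraph E_sub E_mk.
exists T, H; split=> //.
- by rewrite cardsT card_sum !card_ord.
- move=> U hU cardU.
  have /subsetPn[v _ vU] : ~~ ([set: T] \subset U).
    apply/negP=> /subset_leq_card.
    by rewrite cardsT card_sum !card_ord cardU; lia.
  pose high (x : T) := if v is inl w then
    if x is inl j then path_colour w j else false else false.
  apply: (agreeing_order_of_colouring _ label high label_inj) => e y /=.
  rewrite inE => /andP[_ eU] ye y_neq.
  case: (mk_min e) => [[i eE] | min_e]; last first.
    left; rewrite ltn_neqAle min_e // andbT.
    by apply: contraNneq y_neq => /label_inj ->.
  have vE : v \notin e by apply: contraNN vU; apply: (subsetP eU).
  move: ye y_neq vE; rewrite eE mk_arc.
  case: y => [j|j]; last by move=> *; left=> /=; have := ltn_ord (ordS i); lia.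
  (* In an arc only the two neighbours of the middle rely on the colouring: the
     apexes have larger labels. *)
  rewrite mem_arc => jP y_neq; rewrite /high.
  case: v {vU high} => [w|w]; last by rewrite inE.
  rewrite mem_arc !negb_or ![w == _]eq_sym => /and3P[w0 w1 w2]; right.
  case/or3P: jP y_neq => /eqP -> => [_|/eqP //|_]; rewrite !path_colour_ordS //.
  by rewrite negbK.
- apply: arcs_not_agreeing => //; first exact: ltnW.
  move=> i; split; last exact: mk_arc.
  by rewrite inE subsetT card_arc ?rE ?eqxx // ltnW.
Qed.
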